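(* There exist a convex $C^1$ function $f\colon\mathbb{R}^2\to\mathbb{R}$ with unique minimizer at the origin, a point $X_0\in\mathbb{R}^2$ with $X_0\neq 0$, and a global solution $X\colon[0,\infty)\to\mathbb{R}^2$ of $$\ddot X(t)+\frac{3}{t}\dot X(t)+\nabla f(X(t))=0\quad (t>0),\qquad X(0)=X_0,\qquad \dot X(0)=0,$$ such that $$\int_0^\infty \|\dot X(t)\|\,\mathrm{d}t=\infty.$$
   Context: $\|\cdot\|$ is the Euclidean norm on $\mathbb{R}^2$. A global solution is a function $X\in C^1([0,\infty);\mathbb{R}^2)\cap C^2((0,\infty);\mathbb{R}^2)$ satisfying the equation for all $t>0$ together with the initial conditions. *)

(* Defs.v *)
From Stdlib Require Import Reals.
From Coquelicot Require Import Coquelicot.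
Open Scope R_scope.

Notation R2 := (R * R)%type.

(* Coquelicot's product norm is the l^2 combination of the norms of the
   components, so [norm] on [R2] is the Euclidean norm. *)
Lemma norm_R2 (x : R2) : norm x = sqrt (fst x ^ 2 + snd x ^ 2).
Proof.
change (norm x) with (sqrt (Rabs (fst x) ^ 2 + Rabs (snd x) ^ 2)).
now rewrite !pow2_abs.
Qed.

Definition inner (x y : R2) : R := fst x * fst y + snd x * snd y.

Definition grad (f : R2 -> R) (x : R2) : R2 :=
  (Derive (fun u => f (u, snd x)) (fst x),
   Derive (fun v => f (fst x, v)) (snd x)).

(* [Derive] is a total function: the first conjunct ensures that [grad f x] is
   the actual gradient (the Fréchet derivative) of [f] at [x]. *)
Definition continuously_differentiable (f : R2 -> R) : Prop :=
  (forall x, filterdiff f (locally x) (fun h => inner (grad f x) h)) /\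
  (forall x, continuous (grad f) x).

Definition convex_fun (f : R2 -> R) : Prop :=
  forall (x y : R2) (l : R), 0 <= l <= 1 ->
    f (plus (scal l x) (scal (1 - l) y)) <= l * f x + (1 - l) * f y.

Definition minimizer (f : R2 -> R) (x : R2) : Prop := forall y, f x <= f y.

(* Differentiation relative to [D]: one-sided at an endpoint belonging to [D],
   so values of [X] outside [D] are irrelevant. *)
Definition derivative_on (D : R -> Prop) (X X' : R -> R2) : Prop :=
  forall t, D t ->
    filterdiff X (within D (locally t)) (fun h => scal h (X' t)).

(* [X] is a global solution and [X'] is its velocity on [0, +oo). *)
Definition global_solution (f : R2 -> R) (X0 : R2) (X X' : R -> R2) : Prop :=
  derivative_on (fun t => 0 <= t) X X' /\
  continuous_on (fun t => 0 <= t) X' /\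
  X 0 = X0 /\ X' 0 = zero /\
  exists X'' : R -> R2,
    derivative_on (fun t => 0 < t) X' X'' /\
    continuous_on (fun t => 0 < t) X'' /\
    (forall t, 0 < t ->
       plus (plus (X'' t) (scal (3 / t) (X' t))) (grad f (X t)) = zero).

(* Main.v *)
Require Import Defs.
From Stdlib Require Import Reals ZArith Lra Lia IndefiniteDescription.
From Coquelicot Require Import Coquelicot.
From mathcomp Require filter.
Open Scope R_scope.

(** The motion can be kept on a line.  Take [f (x, y) = P x + y ^ 2 / 2] with
    [P] convex, even and as close to [|x|] as the [C^1] requirement permits; the
    trajectory is [(x t, 0)] with [x'' + 3 / t x' + P' x = 0].

    Why such a [P] gives infinite length: the function
      [E t = t ^ 2 P (x) + 2 (x + t x' / 2) ^ 2]
    satisfies [E' = - 2 t (x P' (x) - P (x))].  For [P x = |x|], homogeneous of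
    degree one, [E] would be constant, the speed would be of order [1 / t], and
    the length would grow like [ln t].  Since [|x|] is not [C^1], choose instead
    [P' x = 1 / sqrt (1 + ln (1 + 1 / x))] for [x > 0], extended as an odd
    function: it vanishes at the origin, but so slowly that the defect
    [x P' - P] is at most [P / (2 L - 1)], where [L = 1 + ln (1 + 1 / |x|)]
    ([homogeneity_defect]).  As [|x| <= 1 / t] for [t >= 1]
    ([motion_decay]), this gives [E' >= - (2 / t) E / (2 ln t + 1)], so
    [E >= c / (2 ln t + 1)] ([lyapunov_ge]) and [E / t] is not integrable.

    To pass from [E] to the length, the virial identity
      [(t x x' + x ^ 2)' = t x' ^ 2 - t x P' x]
    shows that [t P (x)] is at most [t x' ^ 2] up to terms with bounded integral;
    hence so is [E / t], up to a factor, and [t x' ^ 2] is at most a constant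
    times [|x'|] because [t x'] is bounded ([length_diverges]).

    The equation has a singular coefficient at [t = 0] and a force that is not
    Lipschitz at the origin, so a solution is obtained by a Peano argument
    ([damped_oscillator_exists]).  In the variables [x] and [p = t ^ 3 x'] the
    equation reads [x' = p / t ^ 3], [p' = - t ^ 3 P' x].  Euler polygons for
    this system are locally bounded and equicontinuous, and their pointwise limit
    along a free ultrafilter on the sequence of meshes solves the equation. *)

(** * Limits along an ultrafilter *)

(** Limits along a free ultrafilter replace the extraction of subsequences: the
    same filter serves all times at once. *)
Lemma free_ultrafilter :
  exists U : (nat -> Prop) -> Prop,
    ProperFilter U /\ filter_le U eventually /\
    (forall P : nat -> Prop, U P \/ U (fun n => ~ P n)).
Proof.
assert (Hev : @filter.ProperFilter nat eventually).
{ split.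
  - intros [N HN]. exact (HN N (le_n N)).
  - split.
    + exists 0%nat. now intros n _.
    + intros P Q HP HQ. exact (filter_and P Q HP HQ).
    + intros P Q HPQ HP. exact (filter_imp P Q HPQ HP). }
destruct (filter.ultraFilterLemma Hev) as [U [HU Hle]].
exists U. split; [split | split].
- intros P HP. apply Classical_Prop.NNPP. intros Hex.
  apply (filter.filter_not_empty U (ProperFilter := filter.ultra_proper)).
  apply (filter.filterS (P := P)); [intros n Hn; apply Hex; now exists n | exact HP].
- split.
  + exact filter.filterT.
  + intros P Q HP HQ. exact (filter.filterI HP HQ).
  + intros P Q HPQ HP. exact (filter.filterS HPQ HP).
- exact Hle.
- intros P. exact (filter.in_ultra_setVsetC P HU).
Qed.

Lemma ultrafilter_bounded_lim (U : (nat -> Prop) -> Prop) (u : nat -> R) (M : R) :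
  ProperFilter U ->
  (forall P : nat -> Prop, U P \/ U (fun n => ~ P n)) ->
  (forall n, Rabs (u n) <= M) ->
  exists l, filterlim u U (locally l).
Proof.
intros HU Hult HM.
assert (Hb : forall n, - M <= u n <= M).
{ intros n. apply Rabs_le_between, HM. }
destruct (completeness (fun r => U (fun n => r <= u n))) as [l [Hub Hleast]].
- exists M. intros r Hr. destruct (filter_ex _ Hr) as [n Hn].
  specialize (Hb n). lra.
- exists (- M). apply filter_forall. intros n. apply Hb.
- exists l. apply filterlim_locally. intros eps.
  assert (Hlow : U (fun n => l - eps < u n)).
  { destruct (Hult (fun n => l - eps < u n)) as [H | H]; [exact H |].
    exfalso. assert (Hl : l <= l - eps).
    { apply Hleast. intros r Hr.
      destruct (filter_ex _ (filter_and _ _ H Hr)) as [n [Hn1 Hn2]]. lra. }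
    destruct eps as [e He]; simpl in Hl; lra. }
  assert (Hup : U (fun n => u n < l + eps)).
  { destruct (Hult (fun n => l + eps <= u n)) as [H | H].
    - apply Hub in H. destruct eps as [e He]; simpl in H; lra.
    - revert H. apply filter_imp. intros n Hn. lra. }
  generalize (filter_and _ _ Hlow Hup). apply filter_imp. intros n [H1 H2].
  change (Rabs (u n - l) < eps). apply Rabs_def1; lra.
Qed.

Lemma filterlim_Rminus {T : Type} {F : (T -> Prop) -> Prop} {FF : Filter F}
    (f g : T -> R) (a b : R) :
  filterlim f F (locally a) -> filterlim g F (locally b) ->
  filterlim (fun x => f x - g x) F (locally (a - b)).
Proof.
intros Hf Hg.
apply (filterlim_comp_2 (H := locally (opp b)) f (fun x => opp (g x)) plus Hf).
- exact (filterlim_comp _ _ _ _ _ _ _ _ Hg (filterlim_opp b)).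
- exact (filterlim_plus a (opp b)).
Qed.

Lemma filterlim_Rmult {T : Type} {F : (T -> Prop) -> Prop} {FF : Filter F}
    (f g : T -> R) (a b : R) :
  filterlim f F (locally a) -> filterlim g F (locally b) ->
  filterlim (fun x => f x * g x) F (locally (a * b)).
Proof.
intros Hf Hg. exact (filterlim_comp_2 f g mult Hf Hg (filterlim_mult a b)).
Qed.

(** * Euler polygons *)

Definition mesh (n : nat) : R := / INR (S n).

Definition last_node (n : nat) (t : R) : nat := Z.to_nat (Int_part (t * INR (S n))).

Lemma mesh_pos n : 0 < mesh n.
Proof. apply Rinv_0_lt_compat, lt_0_INR. lia. Qed.

Lemma mesh_eventually_small (d : R) : 0 < d -> eventually (fun n => mesh n < d).
Proof.
intros Hd. destruct (archimed_cor1 d Hd) as [N [HN HN0]].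
exists N. intros n Hn. apply Rle_lt_trans with (/ INR N); [| exact HN].
apply Rinv_le_contravar; [apply lt_0_INR; lia | apply le_INR; lia].
Qed.

Lemma last_node_nonpos n t : t <= 0 -> last_node n t = 0%nat.
Proof.
intros Ht. unfold last_node. generalize (lt_0_INR (S n) ltac:(lia)); intros Hn.
destruct (base_Int_part (t * INR (S n))) as [H _].
assert (Hi : IZR (Int_part (t * INR (S n))) <= 0) by nra.
apply le_IZR in Hi. lia.
Qed.

Lemma last_node_spec n t : 0 <= t ->
  t - mesh n < INR (last_node n t) * mesh n <= t.
Proof.
intros Ht. unfold last_node. generalize (lt_0_INR (S n) ltac:(lia)); intros Hn.
destruct (base_Int_part (t * INR (S n))) as [H1 H2].
assert (Hi : (0 <= Int_part (t * INR (S n)))%Z).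
{ assert (H : -1 < IZR (Int_part (t * INR (S n)))) by nra.
  apply lt_IZR in H. lia. }
rewrite INR_IZR_INZ, Z2Nat.id by exact Hi.
assert (Hp := mesh_pos n).
assert (Hnp : INR (S n) * mesh n = 1) by (apply Rinv_r; lra).
set (z := IZR _) in *.
assert (Ht' : t = t * INR (S n) * mesh n) by (rewrite Rmult_assoc, Hnp; ring).
assert (H3 := Rmult_le_compat_r _ _ _ (Rlt_le _ _ Hp) H1).
assert (H4 := Rmult_lt_compat_r _ _ _ Hp H2).
split; lra.
Qed.

Lemma last_node_mono n s t : s <= t -> (last_node n s <= last_node n t)%nat.
Proof.
intros Hst. destruct (Rle_lt_dec s 0) as [Hs | Hs].
{ rewrite (last_node_nonpos n s Hs). lia. }
assert (Hh := mesh_pos n).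
destruct (last_node_spec n s) as [_ H1]; [lra |].
destruct (last_node_spec n t) as [H2 _]; [lra |].
apply Nat.lt_succ_r, INR_lt. rewrite S_INR. nra.
Qed.

(** If the slopes stay within [e] of [c], so does the slope of every chord.  With
    [c = 0] this gives equicontinuity, with [c] the expected derivative it gives
    differentiability of the limit. *)
Lemma euler_increment (u phi : nat -> R) (h c e : R) (j k : nat) :
  0 <= h -> (forall i, u (S i) = u i + h * phi i) -> (j <= k)%nat ->
  (forall i, (j <= i < k)%nat -> Rabs (phi i - c) <= e) ->
  Rabs (u k - u j - (INR k * h - INR j * h) * c) <= e * (INR k * h - INR j * h).
Proof.
intros Hh Hu Hjk. induction Hjk as [| k Hjk IH]; intros Hphi.
- replace (u j - u j - (INR j * h - INR j * h) * c) with 0 by ring.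
  rewrite Rabs_R0. lra.
- rewrite Hu, S_INR.
  replace (u k + h * phi k - u j - ((INR k + 1) * h - INR j * h) * c)
    with ((u k - u j - (INR k * h - INR j * h) * c) + h * (phi k - c)) by ring.
  eapply Rle_trans; [apply Rabs_triang |].
  rewrite Rabs_mult, (Rabs_pos_eq h Hh).
  specialize (IH ltac:(intros i Hi; apply Hphi; lia)).
  specialize (Hphi k ltac:(lia)). nra.
Qed.

Section Grid.

Variable U : (nat -> Prop) -> Prop.
Hypothesis HU : ProperFilter U.
Hypothesis Hfree : filter_le U eventually.

(** The filter of pairs (mesh index, node index) whose node tends to [a] while the
    mesh is refined along [U].  Convergence along it plays the role of locally
    uniform convergence of the polygons, and passes through continuous functions
    by composition. *)
Definition near_node (a : R) (P : nat * nat -> Prop) : Prop :=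
  exists d, 0 < d /\
    U (fun n => forall i, Rabs (INR i * mesh n - a) < d -> P (n, i)).

Global Instance near_node_filter a : Filter (near_node a).
Proof.
split.
- exists 1. split; [lra |]. now apply filter_forall.
- intros P Q [d [Hd HP]] [e [He HQ]]. exists (Rmin d e).
  split; [now apply Rmin_glb_lt |].
  generalize (filter_and _ _ HP HQ). apply filter_imp. intros n [H1 H2] i Hi.
  split; [apply H1 | apply H2]; eapply Rlt_le_trans; try exact Hi;
    [apply Rmin_l | apply Rmin_r].
- intros P Q HPQ [d [Hd HP]]. exists d. split; [exact Hd |].
  revert HP. apply filter_imp. intros n Hn i Hi. now apply HPQ, Hn.
Qed.

Lemma last_node_lim t : 0 <= t ->
  filterlim (fun n => INR (last_node n t) * mesh n) U (locally t).
Proof.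
intros Ht. apply filterlim_locally. intros eps.
generalize (Hfree _ (mesh_eventually_small eps (cond_pos eps))).
apply filter_imp. intros n Hn. change (Rabs (INR (last_node n t) * mesh n - t) < eps).
destruct (last_node_spec n t Ht). apply Rabs_def1; lra.
Qed.

Lemma next_node_lim a :
  filterlim (fun q : nat * nat => INR (S (snd q)) * mesh (fst q)) (near_node a) (locally a).
Proof.
apply filterlim_locally. intros eps. exists (eps / 2).
assert (He := cond_pos eps).
split; [lra |].
generalize (Hfree _ (mesh_eventually_small (eps / 2) ltac:(lra))).
apply filter_imp. intros n Hn i Hi.
change (Rabs (INR (S i) * mesh n - a) < eps). rewrite S_INR.
assert (Hm := mesh_pos n).
apply Rabs_def2 in Hi. apply Rabs_def1; lra.
Qed.

Variables (u phi : nat -> nat -> R).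
Hypothesis Hstep : forall n i, u n (S i) = u n i + mesh n * phi n i.

(** Locally bounded slopes upgrade convergence at the single time [a] to
    convergence at all nodes near [a]: the polygons are equi-Lipschitz there. *)
Lemma euler_equicontinuous (a l B : R) : 0 <= a ->
  filterlim (fun n => u n (last_node n a)) U (locally l) ->
  near_node a (fun q => Rabs (phi (fst q) (snd q)) <= B) ->
  filterlim (fun q => u (fst q) (snd q)) (near_node a) (locally l).
Proof.
intros Ha Hl [d0 [Hd0 HB]]. apply filterlim_locally. intros eps.
assert (He := cond_pos eps).
set (d := Rmin d0 (eps / (4 * (Rabs B + 1)))).
assert (HB0 := Rabs_pos B). assert (HB1 := Rle_abs B).
assert (Hd : 0 < d).
{ apply Rmin_glb_lt; [exact Hd0 |]. apply Rdiv_lt_0_compat; lra. }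
assert (Hdd : d <= d0) by apply Rmin_l.
assert (Hde : d * (4 * (Rabs B + 1)) <= eps).
{ apply Rle_div_r; [lra |]. apply Rmin_r. }
exists d. split; [exact Hd |].
assert (Hm := Hfree _ (mesh_eventually_small d Hd)).
assert (Hl2 := proj1 (filterlim_locally _ l) Hl (pos_div_2 eps)).
generalize (filter_and _ _ HB (filter_and _ _ Hm Hl2)). apply filter_imp.
intros n (Hn1 & Hn2 & Hn3) i Hi. simpl.
change (Rabs (u n (last_node n a) - l) < eps / 2) in Hn3.
change (Rabs (u n i - l) < eps).
assert (Hi' := Hi). apply Rabs_def2 in Hi'.
assert (Hpos := mesh_pos n).
destruct (last_node_spec n a Ha) as [Hk1 Hk2].
set (k := last_node n a) in *.
assert (Hki : Rabs (u n i - u n k) <= B * (2 * d)).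
{ assert (Hgen : forall j m, (j <= m)%nat -> a - d < INR j * mesh n ->
      INR m * mesh n < a + d -> Rabs (u n m - u n j) <= B * (2 * d)).
  { intros j m Hjm Hj1 Hm1.
    assert (Hjm' : INR j * mesh n <= INR m * mesh n).
    { apply Rmult_le_compat_r; [lra | now apply le_INR]. }
    assert (HBpos : 0 <= B).
    { eapply Rle_trans; [apply Rabs_pos | apply (Hn1 j)].
      apply Rabs_def1; lra. }
    generalize (euler_increment (u n) (phi n) (mesh n) 0 B j m ltac:(lra) (Hstep n) Hjm).
    intros Hinc. rewrite Rmult_0_r, Rminus_0_r in Hinc.
    eapply Rle_trans; [apply Hinc |].
    - intros q Hq. rewrite Rminus_0_r. apply (Hn1 q).
      assert (INR j * mesh n <= INR q * mesh n)
        by (apply Rmult_le_compat_r; [lra | apply le_INR; lia]).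
      assert (INR q * mesh n <= INR m * mesh n)
        by (apply Rmult_le_compat_r; [lra | apply le_INR; lia]).
      apply Rabs_def1; lra.
    - apply Rmult_le_compat_l; lra. }
  destruct (Nat.le_ge_cases i k) as [Hik | Hik].
  - rewrite Rabs_minus_sym. apply Hgen; [exact Hik | lra | lra].
  - apply Hgen; [exact Hik | lra | lra]. }
replace (u n i - l) with ((u n i - u n k) + (u n k - l)) by ring.
eapply Rle_lt_trans; [apply Rabs_triang |].
nra.
Qed.

(** A limit of polygons is differentiable as soon as the slopes converge near [a]:
    the chord estimate survives the passage to the limit. *)
Lemma euler_derive (y : R -> R) (a c : R) : 0 < a ->
  (forall t, filterlim (fun n => u n (last_node n t)) U (locally (y t))) ->
  filterlim (fun q => phi (fst q) (snd q)) (near_node a) (locally c) ->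
  is_derive y a c.
Proof.
intros Ha Hy Hphi.
assert (Hest : forall eps : posreal, exists d, 0 < d /\ forall s t,
  0 <= s -> a - d < s -> s <= t -> t < a + d ->
  Rabs (y t - y s - (t - s) * c) <= eps * (t - s)).
{ intros eps.
  destruct (proj1 (filterlim_locally _ c) Hphi eps) as [d [Hd HP]].
  exists d. split; [exact Hd |]. intros s t Hs1 Hs2 Hst Ht.
  assert (Hm := Hfree _ (mesh_eventually_small (s - (a - d)) ltac:(lra))).
  set (k := fun (n : nat) r => INR (last_node n r) * mesh n).
  assert (Hk : forall r r', 0 <= r -> 0 <= r' ->
    filterlim (fun n => k n r' - k n r) U (locally (r' - r))).
  { intros r r' Hr Hr'.
    apply filterlim_Rminus; now apply last_node_lim. }
  change (Rbar_le (Finite (Rabs (y t - y s - (t - s) * c))) (Finite (eps * (t - s)))).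
  apply (filterlim_le (F := U)
    (fun n => Rabs (u n (last_node n t) - u n (last_node n s) - (k n t - k n s) * c))
    (fun n => eps * (k n t - k n s))).
  - generalize (filter_and _ _ HP Hm). apply filter_imp. intros n [Hn1 Hn2].
    assert (Hpos := mesh_pos n).
    apply (euler_increment (u n) (phi n)); [lra | apply Hstep | now apply last_node_mono |].
    intros i Hi. left. apply (Hn1 i).
    destruct (last_node_spec n s Hs1) as [H1 _].
    destruct (last_node_spec n t ltac:(lra)) as [_ H2].
    assert (INR (last_node n s) * mesh n <= INR i * mesh n)
      by (apply Rmult_le_compat_r; [lra | apply le_INR; lia]).
    assert (INR i * mesh n <= INR (last_node n t) * mesh n)
      by (apply Rmult_le_compat_r; [lra | apply le_INR; lia]).
    apply Rabs_def1; lra.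
  - apply (filterlim_comp _ _ _ _ Rabs U (locally (y t - y s - (t - s) * c)));
      [| apply continuous_Rabs].
    apply filterlim_Rminus; [apply filterlim_Rminus; apply Hy |].
    apply filterlim_Rmult; [apply Hk; lra | apply filterlim_const].
  - apply filterlim_Rmult; [apply filterlim_const | apply Hk; lra]. }
apply is_derive_Reals. intros e He.
destruct (Hest (pos_div_2 (mkposreal e He))) as [d [Hd H]]. simpl in H.
assert (Hdm : 0 < Rmin d a) by now apply Rmin_glb_lt.
exists (mkposreal _ Hdm). intros r Hr0 Hr. simpl in Hr.
assert (Hr1 := Rlt_le_trans _ _ _ Hr (Rmin_l d a)).
assert (Hr2 := Rlt_le_trans _ _ _ Hr (Rmin_r d a)).
apply Rabs_def2 in Hr1. apply Rabs_def2 in Hr2.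
assert (Hmain : Rabs (y (a + r) - y a - r * c) <= e / 2 * Rabs r).
{ destruct (Rle_lt_dec 0 r) as [Hs | Hs].
  - rewrite (Rabs_pos_eq r Hs).
    generalize (H a (a + r) ltac:(lra) ltac:(lra) ltac:(lra) ltac:(lra)).
    replace (a + r - a) with r by ring. trivial.
  - rewrite (Rabs_left r Hs).
    generalize (H (a + r) a ltac:(lra) ltac:(lra) ltac:(lra) ltac:(lra)).
    replace (a - (a + r)) with (- r) by ring.
    rewrite <- Rabs_Ropp. replace (- (y a - y (a + r) - - r * c))
      with (y (a + r) - y a - r * c) by ring. trivial. }
replace ((y (a + r) - y a) / r - c) with ((y (a + r) - y a - r * c) / r) by (field; exact Hr0).
unfold Rdiv at 1. rewrite Rabs_mult, Rabs_inv.
assert (Hrp : 0 < Rabs r) by now apply Rabs_pos_lt.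
apply Rmult_lt_reg_r with (Rabs r); [exact Hrp |].
rewrite Rmult_assoc, Rinv_l, Rmult_1_r by lra. nra.
Qed.

End Grid.

(** * Existence of the damped motion *)

(** Explicit Euler scheme for [x' = p / t ^ 3], [p' = - t ^ 3 g x] from
    [(x0, 0)].  The coefficients are evaluated at the right end of each step,
    which avoids the singularity at [t = 0] on the first one. *)
Fixpoint euler (g : R -> R) (h x0 : R) (k : nat) : R * R :=
  match k with
  | O => (x0, 0)
  | S k =>
      let (x, p) := euler g h x0 k in
      (x + h * (p / (INR (S k) * h) ^ 3), p + h * - ((INR (S k) * h) ^ 3 * g x))
  end.

Lemma euler_S g h x0 k :
  euler g h x0 (S k) =
  (fst (euler g h x0 k) + h * (snd (euler g h x0 k) / (INR (S k) * h) ^ 3),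
   snd (euler g h x0 k) + h * - ((INR (S k) * h) ^ 3 * g (fst (euler g h x0 k)))).
Proof. simpl euler. now destruct (euler g h x0 k). Qed.

(** The momentum gains at most [M t ^ 3] per unit of time.  This fourth power is
    what makes the velocity [p / t ^ 3] small near [t = 0]. *)
Lemma euler_momentum_bound g M h x0 k :
  0 < h -> (forall x, Rabs (g x) <= M) ->
  Rabs (snd (euler g h x0 k)) <= M * (INR k * h) ^ 4.
Proof.
intros Hh Hg. induction k as [| k IH].
- simpl. rewrite Rabs_R0. lra.
- rewrite euler_S. cbn [fst snd]. rewrite S_INR.
  set (s := INR k * h) in *.
  replace ((INR k + 1) * h) with (s + h) by (unfold s; ring).
  assert (Hs : 0 <= s) by (apply Rmult_le_pos; [apply pos_INR | lra]).
  specialize (Hg (fst (euler g h x0 k))).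
  set (G := g _) in *. set (p := snd _) in *.
  assert (HM : 0 <= M) by (eapply Rle_trans; [apply Rabs_pos | exact Hg]).
  assert (H3 : 0 <= (s + h) ^ 3) by (apply pow_le; lra).
  eapply Rle_trans; [apply Rabs_triang |].
  rewrite Rabs_mult, Rabs_Ropp, Rabs_mult, (Rabs_pos_eq h), (Rabs_pos_eq _ H3) by lra.
  assert (H34 : s ^ 3 <= (s + h) ^ 3) by (apply pow_incr; lra).
  assert (H1 : (s + h) ^ 3 * Rabs G <= (s + h) ^ 3 * M) by now apply Rmult_le_compat_l.
  assert (H2 : s * s ^ 3 <= s * (s + h) ^ 3) by now apply Rmult_le_compat_l.
  replace (M * (s + h) ^ 4) with (M * (s * (s + h) ^ 3) + h * ((s + h) ^ 3 * M)) by ring.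
  replace (M * s ^ 4) with (M * (s * s ^ 3)) in IH by ring.
  assert (H4 := Rmult_le_compat_l _ _ _ HM H2).
  assert (H5 := Rmult_le_compat_l _ _ _ (Rlt_le _ _ Hh) H1).
  lra.
Qed.

Lemma euler_velocity_bound g M h x0 k :
  0 < h -> (forall x, Rabs (g x) <= M) ->
  Rabs (snd (euler g h x0 k) / (INR (S k) * h) ^ 3) <= M * (INR k * h).
Proof.
intros Hh Hg. assert (Hp := euler_momentum_bound g M h x0 k Hh Hg).
assert (HM : 0 <= M) by (eapply Rle_trans; [apply Rabs_pos | apply (Hg 0)]).
rewrite S_INR. set (s := INR k * h) in *.
replace ((INR k + 1) * h) with (s + h) by (unfold s; ring).
assert (Hs : 0 <= s) by (apply Rmult_le_pos; [apply pos_INR | lra]).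
assert (H3 : 0 < (s + h) ^ 3) by (apply pow_lt; lra).
unfold Rdiv. rewrite Rabs_mult, Rabs_inv, (Rabs_pos_eq _ (Rlt_le _ _ H3)).
apply Rle_div_l; [exact H3 |].
eapply Rle_trans; [exact Hp |].
replace (M * s ^ 4) with (M * s * s ^ 3) by ring.
apply Rmult_le_compat_l; [now apply Rmult_le_pos | apply pow_incr; lra].
Qed.

Lemma euler_displacement_bound g M h x0 k :
  0 < h -> (forall x, Rabs (g x) <= M) ->
  Rabs (fst (euler g h x0 k) - x0) <= M * (INR k * h) ^ 2.
Proof.
intros Hh Hg.
assert (HM : 0 <= M) by (eapply Rle_trans; [apply Rabs_pos | apply (Hg 0)]).
induction k as [| k IH].
- simpl. rewrite Rminus_diag, Rabs_R0. lra.
- rewrite euler_S. cbn [fst snd].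
  assert (Hv := euler_velocity_bound g M h x0 k Hh Hg).
  rewrite S_INR in *. set (s := INR k * h) in *.
  replace ((INR k + 1) * h) with (s + h) in * by (unfold s; ring).
  assert (Hs : 0 <= s) by (apply Rmult_le_pos; [apply pos_INR | lra]).
  set (V := _ / _) in *. set (x := fst _) in *.
  replace (x + h * V - x0) with ((x - x0) + h * V) by ring.
  eapply Rle_trans; [apply Rabs_triang |].
  rewrite Rabs_mult, (Rabs_pos_eq h) by lra.
  assert (H5 := Rmult_le_compat_l _ _ _ (Rlt_le _ _ Hh) Hv).
  assert (0 <= M * (s * h + h * h)) by (apply Rmult_le_pos; nra).
  replace (M * (s + h) ^ 2) with (M * s ^ 2 + h * (M * s) + M * (s * h + h * h)) by ring.
  lra.
Qed.

Lemma last_node_abs n t : 0 <= INR (last_node n t) * mesh n <= Rabs t.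
Proof.
assert (Hm := mesh_pos n). split.
- apply Rmult_le_pos; [apply pos_INR | lra].
- destruct (Rle_lt_dec t 0) as [Ht | Ht].
  + rewrite (last_node_nonpos n t Ht), Rmult_0_l. apply Rabs_pos.
  + rewrite Rabs_pos_eq by lra. apply last_node_spec. lra.
Qed.

Lemma Rabs_filterlim_le {T : Type} {F : (T -> Prop) -> Prop} {FF : ProperFilter F}
    (f : T -> R) (l B : R) :
  filterlim f F (locally l) -> (forall q, Rabs (f q) <= B) -> Rabs l <= B.
Proof.
intros Hf HB.
change (Rbar_le (Finite (Rabs l)) (Finite B)).
apply (filterlim_le (F := F) (fun q => Rabs (f q)) (fun _ => B)).
- now apply filter_forall.
- exact (filterlim_comp _ _ _ _ _ _ _ _ Hf (continuous_Rabs l)).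
- apply filterlim_const.
Qed.

Lemma is_derive_0_of_quadratic (x : R -> R) (a M : R) :
  (forall t, Rabs (x t - x a) <= M * (t - a) ^ 2) -> is_derive x a 0.
Proof.
intros Hx. apply is_derive_Reals. intros e He.
assert (HM : 0 < Rabs M + 1) by (generalize (Rabs_pos M); lra).
exists (mkposreal _ (Rdiv_lt_0_compat _ _ He HM)). intros h Hh0 Hh. simpl in Hh.
specialize (Hx (a + h)). replace (a + h - a) with h in Hx by ring.
rewrite Rminus_0_r. unfold Rdiv. rewrite Rabs_mult, Rabs_inv.
assert (Hhp := Rabs_pos_lt h Hh0).
apply Rlt_div_l; [lra |].
apply Rlt_div_r in Hh; [| lra].
rewrite <- (pow2_abs h) in Hx.
assert (HM2 := Rle_abs M). nra.
Qed.

(** Peano existence for the damped oscillator, global because the force is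
    bounded.  The functions are extended to negative times by the constant motion,
    so that differentiability at [0] is two-sided. *)
Theorem damped_oscillator_exists (g : R -> R) (M x0 : R) :
  (forall x, continuous g x) -> (forall x, Rabs (g x) <= M) ->
  exists x v : R -> R,
    x 0 = x0 /\ v 0 = 0 /\ (forall t, continuous v t) /\
    (forall t, is_derive x t (v t)) /\
    (forall t, 0 < t -> is_derive v t (- (3 / t * v t) - g (x t))).
Proof.
intros Hcont Hg.
assert (HM : 0 <= M) by (eapply Rle_trans; [apply Rabs_pos | apply (Hg 0)]).
destruct free_ultrafilter as [U [HU [Hfree Hult]]].
set (xs := fun n k => fst (euler g (mesh n) x0 k)).
set (ps := fun n k => snd (euler g (mesh n) x0 k)).
set (tau := fun n k => INR (S k) * mesh n).
assert (Hxs : forall n k, xs n (S k) = xs n k + mesh n * (ps n k / tau n k ^ 3)).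
{ intros n k. unfold xs. now rewrite euler_S. }
assert (Hps : forall n k, ps n (S k) = ps n k + mesh n * - (tau n k ^ 3 * g (xs n k))).
{ intros n k. unfold ps. now rewrite euler_S. }
assert (Hxb : forall t n, Rabs (xs n (last_node n t) - x0) <= M * t ^ 2).
{ intros t n. eapply Rle_trans;
    [apply (euler_displacement_bound g M); [apply mesh_pos | exact Hg] |].
  apply Rmult_le_compat_l; [exact HM |]. rewrite <- (pow2_abs t).
  apply pow_incr, last_node_abs. }
assert (Hpb : forall t n, Rabs (ps n (last_node n t)) <= M * t ^ 4).
{ intros t n. eapply Rle_trans;
    [apply (euler_momentum_bound g M); [apply mesh_pos | exact Hg] |].
  apply Rmult_le_compat_l; [exact HM |].
  replace (t ^ 4) with (Rabs t ^ 4).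
  - apply pow_incr, last_node_abs.
  - rewrite RPow_abs. apply Rabs_pos_eq. nra. }
destruct (functional_choice
  (fun t l : R => filterlim (fun n => xs n (last_node n t)) U (locally l))) as [x Hx].
{ intros t. apply (ultrafilter_bounded_lim U _ (Rabs x0 + M * t ^ 2)); auto.
  intros n. replace (xs n (last_node n t)) with (x0 + (xs n (last_node n t) - x0)) by ring.
  eapply Rle_trans; [apply Rabs_triang |]. specialize (Hxb t n). lra. }
destruct (functional_choice
  (fun t l : R => filterlim (fun n => ps n (last_node n t)) U (locally l))) as [p Hp].
{ intros t. exact (ultrafilter_bounded_lim U _ (M * t ^ 4) HU Hult (Hpb t)). }
assert (Hpt : forall t, Rabs (p t) <= M * t ^ 4).
{ intros t. apply (Rabs_filterlim_le _ _ _ (Hp t)), Hpb. }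
assert (Hp0 : forall t, t <= 0 -> p t = 0).
{ intros t Ht. apply Rabs_eq_0, Rle_antisym; [| apply Rabs_pos].
  apply (Rabs_filterlim_le _ _ _ (Hp t)). intros n.
  rewrite last_node_nonpos by exact Ht. unfold ps. simpl. rewrite Rabs_R0. lra. }
assert (Hxt : forall t, Rabs (x t - x0) <= M * t ^ 2).
{ intros t. apply (Rabs_filterlim_le (F := U) (fun n => xs n (last_node n t) - x0)).
  - apply filterlim_Rminus; [apply Hx | apply filterlim_const].
  - apply Hxb. }
assert (Hx0 : forall t, t <= 0 -> x t = x0).
{ intros t Ht. apply Rminus_diag_uniq, Rabs_eq_0, Rle_antisym; [| apply Rabs_pos].
  apply (Rabs_filterlim_le (F := U) (fun n => xs n (last_node n t) - x0)).
  - apply filterlim_Rminus; [apply Hx | apply filterlim_const].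
  - intros n. rewrite last_node_nonpos by exact Ht. unfold xs. simpl.
    rewrite Rminus_diag, Rabs_R0. lra. }
assert (Hnodes : forall a d, 0 < d -> forall P : nat * nat -> Prop,
  (forall n i, mesh n < d -> INR i * mesh n < a + d -> P (n, i)) -> near_node U a P).
{ intros a d Hd P HP. exists d. split; [exact Hd |].
  generalize (Hfree _ (mesh_eventually_small d Hd)). apply filter_imp.
  intros n Hn i Hi. apply HP; [exact Hn |]. apply Rabs_def2 in Hi. lra. }
assert (Hxn : forall a, 0 <= a ->
  filterlim (fun q => xs (fst q) (snd q)) (near_node U a) (locally (x a))).
{ intros a Ha.
  apply (euler_equicontinuous U HU Hfree xs _ Hxs a _ (M * (a + 1)) Ha (Hx a)).
  apply (Hnodes a 1); [lra |]. intros n i _ Hi. cbn [fst snd].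
  eapply Rle_trans; [apply (euler_velocity_bound g M); [apply mesh_pos | exact Hg] |].
  apply Rmult_le_compat_l; lra. }
assert (Hpn : forall a, 0 <= a ->
  filterlim (fun q => ps (fst q) (snd q)) (near_node U a) (locally (p a))).
{ intros a Ha.
  apply (euler_equicontinuous U HU Hfree ps _ Hps a _ ((a + 2) ^ 3 * M) Ha (Hp a)).
  apply (Hnodes a 1); [lra |]. intros n i Hn Hi. cbn [fst snd].
  rewrite Rabs_Ropp, Rabs_mult, <- RPow_abs.
  apply Rmult_le_compat; [apply pow_le, Rabs_pos | apply Rabs_pos | | apply Hg].
  assert (Hm := mesh_pos n).
  assert (Ht : 0 <= tau n i) by (apply Rmult_le_pos; [apply pos_INR | lra]).
  rewrite (Rabs_pos_eq _ Ht). apply pow_incr. split; [exact Ht |].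
  unfold tau. rewrite S_INR. lra. }
assert (Htau3 : forall a,
  filterlim (fun q => tau (fst q) (snd q) ^ 3) (near_node U a) (locally (a ^ 3))).
{ intros a. apply (filterlim_comp _ _ _ (fun q => tau (fst q) (snd q))
    (fun s : R => s ^ 3) _ (locally a)).
  - exact (next_node_lim U HU Hfree a).
  - apply (ex_derive_continuous (fun s : R => s ^ 3) a). auto_derive. exact I. }
assert (Dx : forall a, 0 < a -> is_derive x a (p a / a ^ 3)).
{ intros a Ha. apply (euler_derive U HU Hfree xs _ Hxs x a _ Ha Hx).
  apply filterlim_Rmult; [apply Hpn; lra |].
  apply (filterlim_comp _ _ _ (fun q => tau (fst q) (snd q) ^ 3) Rinv _
    (locally (a ^ 3)) _ (Htau3 a)).
  apply (ex_derive_continuous Rinv (a ^ 3)). auto_derive. apply pow_nonzero. lra. }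
assert (Dp : forall a, 0 < a -> is_derive p a (- (a ^ 3 * g (x a)))).
{ intros a Ha. apply (euler_derive U HU Hfree ps _ Hps p a _ Ha Hp).
  apply (filterlim_comp _ _ _ (fun q => tau (fst q) (snd q) ^ 3 * g (xs (fst q) (snd q)))
    opp _ (locally (a ^ 3 * g (x a)))); [| exact (filterlim_opp (a ^ 3 * g (x a)))].
  apply filterlim_Rmult; [apply Htau3 |].
  apply (filterlim_comp _ _ _ (fun q => xs (fst q) (snd q)) g _ (locally (x a))).
  - apply Hxn. lra.
  - apply Hcont. }
assert (Dv : forall t, 0 < t ->
  is_derive (fun t => p t / t ^ 3) t (- (3 / t * (p t / t ^ 3)) - g (x t))).
{ intros t Ht.
  evar_last.
  - apply (is_derive_mult p (fun t => / t ^ 3) t _ (- 3 / t ^ 4) (Dp t Ht)).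
    + auto_derive; [change (t ^ 3 <> 0); apply pow_nonzero; lra | field; lra].
    + intros; apply Rmult_comm.
  - unfold plus, mult; simpl. field. lra. }
assert (Hv : forall t, Rabs (p t / t ^ 3) <= M * Rabs t).
{ intros t. destruct (Rle_lt_dec t 0) as [Ht | Ht].
  - rewrite (Hp0 t Ht). unfold Rdiv. rewrite Rmult_0_l, Rabs_R0.
    apply Rmult_le_pos; [exact HM | apply Rabs_pos].
  - assert (H3 : 0 < t ^ 3) by (apply pow_lt; lra).
    unfold Rdiv. rewrite Rabs_mult, Rabs_inv, (Rabs_pos_eq (t ^ 3)), (Rabs_pos_eq t) by lra.
    apply Rle_div_l; [exact H3 |]. specialize (Hpt t).
    replace (M * t * t ^ 3) with (M * t ^ 4) by ring. exact Hpt. }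
exists x, (fun t => p t / t ^ 3).
split; [apply Hx0; lra |].
split; [rewrite (Hp0 0) by lra; unfold Rdiv; ring |].
split; [| split; [| exact Dv]].
- intros t. destruct (Rtotal_order t 0) as [Ht | [-> | Ht]].
  + apply (continuous_ext_loc _ (fun _ => 0)); [| apply continuous_const].
    exists (mkposreal (- t) ltac:(lra)). intros s Hs.
    change (Rabs (s - t) < - t) in Hs. apply Rabs_def2 in Hs.
    rewrite (Hp0 s) by lra. symmetry. apply Rmult_0_l.
  + apply filterlim_locally. intros eps.
    assert (He := cond_pos eps).
    exists (mkposreal (eps / (M + 1)) ltac:(apply Rdiv_lt_0_compat; lra)). intros s Hs.
    change (Rabs (s - 0) < eps / (M + 1)) in Hs. rewrite Rminus_0_r in Hs.
    apply Rlt_div_r in Hs; [| lra].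
    change (Rabs (p s / s ^ 3 - p 0 / 0 ^ 3) < eps).
    rewrite (Hp0 0) by lra.
    replace (p s / s ^ 3 - 0 / 0 ^ 3) with (p s / s ^ 3) by (unfold Rdiv; ring).
    generalize (Hv s) (Rabs_pos s). nra.
  + apply (ex_derive_continuous (fun t : R => p t / t ^ 3) t). eexists. now apply Dv.
- intros t. destruct (Rtotal_order t 0) as [Ht | [-> | Ht]].
  + rewrite (Hp0 t) by lra. replace (0 / t ^ 3) with 0 by (unfold Rdiv; ring).
    apply (is_derive_ext_loc (fun _ => x0)); [| apply @is_derive_const].
    exists (mkposreal (- t) ltac:(lra)). intros s Hs.
    change (Rabs (s - t) < - t) in Hs. apply Rabs_def2 in Hs.
    rewrite (Hx0 s); [reflexivity | lra].
  + rewrite (Hp0 0) by lra. replace (0 / 0 ^ 3) with 0 by (unfold Rdiv; ring).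
    apply (is_derive_0_of_quadratic x 0 M). intros t.
    rewrite (Hx0 0), Rminus_0_r by lra. apply Hxt.
  + now apply Dx.
Qed.

(** * The one-dimensional potential *)

Lemma nondecreasing_of_derive (f df : R -> R) (a b : R) :
  a <= b ->
  (forall x, a <= x <= b -> continuous f x) ->
  (forall x, a < x < b -> is_derive f x (df x)) ->
  (forall x, a < x < b -> 0 <= df x) ->
  f a <= f b.
Proof.
intros Hab Hc Hd Hpos.
(* [MVT_gen] may return an endpoint, where nothing is known of [df]: truncate it. *)
destruct (MVT_gen f a b (fun x => Rmax 0 (df x))) as [c [_ Hc']];
  rewrite ?Rmin_left, ?Rmax_right by lra.
- intros x Hx. rewrite Rmax_right; [now apply Hd | now apply Hpos].
- intros x Hx. apply continuity_pt_filterlim, Hc, Hx.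
- assert (H := Rmax_l 0 (df c)). nra.
Qed.

Lemma tangent_below (f g : R -> R) (x z : R) :
  (forall x, is_derive f x (g x)) -> (forall x y, x <= y -> g x <= g y) ->
  f z + g z * (x - z) <= f x.
Proof.
intros Hd Hg.
destruct (MVT_gen f z x g) as [c [Hc Hmvt]].
- intros y _. apply Hd.
- intros y _. apply continuity_pt_filterlim.
  apply (ex_derive_continuous f y). eexists. apply Hd.
- destruct (Rle_lt_dec z x) as [H | H].
  + rewrite Rmin_left, Rmax_right in Hc by lra.
    assert (g z <= g c) by (apply Hg; lra). nra.
  + rewrite Rmin_right, Rmax_left in Hc by lra.
    assert (g c <= g z) by (apply Hg; lra). nra.
Qed.

Lemma convex_of_monotone_derive (f g : R -> R) (x y l : R) :
  (forall x, is_derive f x (g x)) -> (forall x y, x <= y -> g x <= g y) ->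
  0 <= l <= 1 -> f (l * x + (1 - l) * y) <= l * f x + (1 - l) * f y.
Proof.
intros Hd Hg Hl. set (z := l * x + (1 - l) * y).
assert (Hx := tangent_below f g x z Hd Hg).
assert (Hy := tangent_below f g y z Hd Hg).
assert (Hz : l * (g z * (x - z)) + (1 - l) * (g z * (y - z)) = 0) by (unfold z; ring).
assert (H1 := Rmult_le_compat_l l _ _ ltac:(lra) Hx).
assert (H2 := Rmult_le_compat_l (1 - l) _ _ ltac:(lra) Hy).
nra.
Qed.

Definition log_weight (s : R) : R := 1 + ln (1 + / s).

(** At [x = 0] the quotient is [0 * / 0 = 0], the value that makes the
    function odd and continuous. *)
Definition force (x : R) : R := x / Rabs x / sqrt (log_weight (Rabs x)).

Definition potential (x : R) : R := RInt force 0 x.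

Lemma log_weight_ge_1 s : 0 < s -> 1 <= log_weight s.
Proof.
intros Hs. unfold log_weight. assert (H := Rinv_0_lt_compat s Hs).
assert (0 <= ln (1 + / s)); [| lra].
rewrite <- ln_1. apply ln_le; lra.
Qed.

Lemma log_weight_antitone s t : 0 < s -> s <= t -> log_weight t <= log_weight s.
Proof.
intros Hs Hst. unfold log_weight.
assert (H := Rinv_0_lt_compat t ltac:(lra)).
assert (H1 := Rinv_le_contravar s t Hs Hst).
assert (ln (1 + / t) <= ln (1 + / s)); [apply ln_le |]; lra.
Qed.

Lemma force_pos x : 0 < x -> force x = / sqrt (log_weight x).
Proof. intros Hx. unfold force. rewrite Rabs_pos_eq by lra. field.
  assert (H := log_weight_ge_1 x Hx).
  split; [| lra]. apply Rgt_not_eq, sqrt_lt_R0. lra.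
Qed.

Lemma force_opp x : force (- x) = - force x.
Proof. unfold force. rewrite Rabs_Ropp. unfold Rdiv. ring. Qed.

Lemma force_0 : force 0 = 0.
Proof. unfold force, Rdiv. ring. Qed.

Lemma force_pos_bounds x : 0 < x -> 0 < force x <= 1.
Proof.
intros Hx. rewrite (force_pos x Hx).
assert (H := log_weight_ge_1 x Hx).
assert (H1 : 1 <= sqrt (log_weight x)) by (rewrite <- sqrt_1; now apply sqrt_le_1_alt).
split.
- apply Rinv_0_lt_compat. lra.
- rewrite <- Rinv_1. apply Rinv_le_contravar; lra.
Qed.

Lemma force_sqr x : 0 < x -> force x ^ 2 * log_weight x = 1.
Proof.
intros Hx. assert (H := log_weight_ge_1 x Hx).
rewrite (force_pos x Hx), pow_inv, pow2_sqrt by lra. field. lra.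
Qed.

Lemma force_bound x : Rabs (force x) <= 1.
Proof.
destruct (Rtotal_order x 0) as [Hx | [-> | Hx]].
- replace x with (- - x) by ring. rewrite force_opp, Rabs_Ropp.
  destruct (force_pos_bounds (- x)); [lra |]. rewrite Rabs_pos_eq; lra.
- rewrite force_0, Rabs_R0. lra.
- destruct (force_pos_bounds x Hx). rewrite Rabs_pos_eq; lra.
Qed.

Lemma force_monotone x y : x <= y -> force x <= force y.
Proof.
assert (Hpos : forall x y, 0 < x -> x <= y -> force x <= force y).
{ intros s t Hs Hst. rewrite !force_pos by lra.
  assert (H := log_weight_ge_1 t ltac:(lra)).
  apply Rinv_le_contravar; [apply sqrt_lt_R0; lra |].
  now apply sqrt_le_1_alt, log_weight_antitone. }
assert (Hnn : forall x, 0 <= x -> 0 <= force x).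
{ intros s [Hs | <-]; [left; now apply force_pos_bounds | rewrite force_0; lra]. }
intros Hxy. destruct (Rle_lt_dec x 0) as [Hx | Hx]; [| now apply Hpos].
destruct (Rle_lt_dec 0 y) as [Hy | Hy].
- assert (H1 := Hnn y Hy). assert (H2 := Hnn (- x) ltac:(lra)).
  rewrite force_opp in H2. lra.
- assert (H := Hpos (- y) (- x) ltac:(lra) ltac:(lra)).
  rewrite !force_opp in H. lra.
Qed.

Lemma force_derive x : 0 < x ->
  is_derive force x (force x ^ 3 / (2 * (x * (1 + x)))).
Proof.
intros Hx.
apply (is_derive_ext_loc (fun s => / sqrt (log_weight s))).
- exists (mkposreal x Hx). intros s Hs. change (Rabs (s - x) < x) in Hs.
  apply Rabs_def2 in Hs. symmetry. apply force_pos. lra.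
- rewrite (force_pos x Hx). assert (H := log_weight_ge_1 x Hx).
  assert (Hsq : 0 < sqrt (log_weight x)) by (apply sqrt_lt_R0; lra).
  assert (Hi := Rinv_0_lt_compat x Hx).
  unfold log_weight in *. auto_derive.
  + repeat split; try lra.
  + set (q := sqrt _) in *. field. lra.
Qed.

(** At the origin, [force r < eps] as soon as [ln (/ r) > / eps ^ 2]. *)
Lemma force_continuous x : continuous force x.
Proof.
assert (Hpos : forall x, 0 < x -> continuous force x).
{ intros s Hs. apply (ex_derive_continuous force s). eexists. now apply force_derive. }
destruct (Rtotal_order x 0) as [Hx | [-> | Hx]]; [| | now apply Hpos].
- apply (continuous_ext (fun s : R => opp (force (opp s)))).
  { intros s. change (- force (- s) = force s). rewrite force_opp. ring. }
  apply (continuous_opp (fun s : R => force (opp s)) x).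
  apply (continuous_comp Ropp force); [exact (filterlim_opp x) |].
  apply Hpos. change (0 < - x). lra.
- apply filterlim_locally. intros eps. assert (He := cond_pos eps).
  set (d := exp (- / eps ^ 2)).
  exists (mkposreal d (exp_pos _)). intros s Hs.
  change (Rabs (s - 0) < d) in Hs. change (Rabs (force s - force 0) < eps).
  rewrite force_0. rewrite !Rminus_0_r in *.
  assert (Hgen : forall r, 0 < r < d -> force r < eps).
  { intros r [Hr Hrd]. rewrite (force_pos r Hr).
    assert (HL : / eps ^ 2 < log_weight r).
    { unfold log_weight. apply Rlt_trans with (ln (/ r)).
      - rewrite ln_Rinv by exact Hr. apply ln_increasing in Hrd; [| exact Hr].
        unfold d in Hrd. rewrite ln_exp in Hrd. lra.
      - assert (Hi := Rinv_0_lt_compat r Hr).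
        assert (ln (/ r) < ln (1 + / r)) by (apply ln_increasing; lra). lra. }
    assert (He2 : 0 < eps ^ 2) by (apply pow_lt; lra).
    assert (Hie := Rinv_0_lt_compat _ He2).
    rewrite <- (Rinv_inv eps).
    apply Rinv_lt_contravar.
    - apply Rmult_lt_0_compat; [apply Rinv_0_lt_compat; lra |]. apply sqrt_lt_R0. lra.
    - rewrite <- (sqrt_pow2 (/ eps)) by (left; now apply Rinv_0_lt_compat).
      apply sqrt_lt_1_alt. rewrite pow_inv. lra. }
  destruct (Rtotal_order s 0) as [H | [-> | H]].
  + rewrite (Rabs_left s H) in Hs. rewrite <- Rabs_Ropp, <- force_opp.
    rewrite Rabs_pos_eq by (left; apply force_pos_bounds; lra). apply Hgen. lra.
  + rewrite force_0, Rabs_R0. exact He.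
  + rewrite (Rabs_pos_eq s) in Hs by lra.
    rewrite Rabs_pos_eq by (left; apply force_pos_bounds; lra). apply Hgen. lra.
Qed.

Lemma potential_derive x : is_derive potential x (force x).
Proof.
apply (is_derive_RInt force potential 0 x); [| apply force_continuous].
apply filter_forall. intros y. apply (RInt_correct force).
apply (ex_RInt_continuous force). intros z _. apply force_continuous.
Qed.

Lemma potential_continuous x : continuous potential x.
Proof. apply (ex_derive_continuous potential x). eexists. apply potential_derive. Qed.

Lemma potential_0 : potential 0 = 0.
Proof. exact (RInt_point 0 force). Qed.

Lemma potential_opp x : potential (- x) = potential x.
Proof.
unfold potential.
assert (H : ex_RInt force (- 0) (- x)).
{ apply (ex_RInt_continuous force). intros z _. apply force_continuous. }
assert (H1 := is_RInt_comp_opp force 0 x _ (RInt_correct force _ _ H)).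
rewrite Ropp_0 in H1.
rewrite <- (is_RInt_unique (V := R_CompleteNormedModule) _ _ _ _ H1).
apply RInt_ext. intros y _. rewrite force_opp. apply Ropp_involutive.
Qed.

Lemma potential_le x : potential x <= x * force x.
Proof.
assert (H := tangent_below potential force 0 x potential_derive force_monotone).
rewrite potential_0 in H. lra.
Qed.

(** The right member minus the left one has a nonnegative derivative: the slope of
    [s (a - a ^ 3 / 2)], with [a = force s], falls short of [a] because
    [s a'] is [a ^ 3 / (2 (1 + s))]. *)
Lemma potential_ge x : 0 < x -> x * (force x - force x ^ 3 / 2) <= potential x.
Proof.
intros Hx.
set (H := fun s => potential s - s * (force s - force s ^ 3 / 2)).
assert (Hle : H 0 <= H x).
{ apply (nondecreasing_of_derive H
    (fun s => force s ^ 3 / 2 * (1 - (1 - 3 / 2 * force s ^ 2) / (1 + s)))); [lra | | |].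
  - intros s _. unfold H.
    apply (continuous_minus potential); [apply potential_continuous |].
    apply (continuous_mult (fun s : R => s)); [apply continuous_id |].
    apply (continuous_comp force (fun r => r - r ^ 3 / 2)); [apply force_continuous |].
    apply (ex_derive_continuous (fun r : R => r - r ^ 3 / 2)). auto_derive. exact I.
  - intros s Hs. unfold H. evar_last.
    + apply (is_derive_minus potential); [apply potential_derive |].
      apply (is_derive_mult (fun s : R => s)); [apply is_derive_id | | intros; apply Rmult_comm].
      apply (is_derive_comp (fun r => r - r ^ 3 / 2) force s
        (1 - 3 / 2 * force s ^ 2)).
      * auto_derive; [exact I | field].
      * apply force_derive. lra.
    + unfold minus, plus, opp, mult, scal, one; simpl. unfold mult; simpl. field. lra.
  - intros s Hs. destruct (force_pos_bounds s) as [H1 H2]; [lra |].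
    apply Rmult_le_pos; [generalize (pow_lt _ 3 H1); lra |].
    assert (H3 : (1 - 3 / 2 * force s ^ 2) / (1 + s) <= 1); [| lra].
    apply Rle_div_l; [lra |]. nra. }
unfold H in Hle. rewrite potential_0, Rmult_0_l, Rminus_diag in Hle. lra.
Qed.

Lemma potential_ge_half x : 0 < x -> x * force x / 2 <= potential x.
Proof.
intros Hx. assert (H := potential_ge x Hx).
destruct (force_pos_bounds x Hx) as [H1 H2].
assert (H3 : force x ^ 3 <= force x) by nra.
assert (H4 := Rmult_le_compat_l x _ _ (Rlt_le _ _ Hx) H3). lra.
Qed.

Lemma potential_nonneg x : 0 <= potential x.
Proof.
assert (H := tangent_below potential force x 0 potential_derive force_monotone).
rewrite potential_0, force_0 in H. lra.
Qed.

Lemma potential_pos x : x <> 0 -> 0 < potential x.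
Proof.
assert (Hpos : forall x, 0 < x -> 0 < potential x).
{ intros s Hs. assert (H := potential_ge_half s Hs).
  destruct (force_pos_bounds s Hs) as [H1 _]. nra. }
intros Hx. destruct (Rle_lt_dec x 0) as [H | H]; [| now apply Hpos].
rewrite <- potential_opp. apply Hpos. lra.
Qed.

(** The Lyapunov function loses [2 t] times the defect [x P' - P]
    per unit of time.  The exponent [1 / 2] of the logarithm in [force] is
    what produces the factor [2] in front of [log_weight]. *)
Lemma homogeneity_defect x :
  (2 * log_weight (Rabs x) - 1) * (x * force x - potential x) <= potential x.
Proof.
assert (Hpos : forall x, 0 < x ->
  (2 * log_weight x - 1) * (x * force x - potential x) <= potential x).
{ intros s Hs. assert (H := potential_ge s Hs).
  assert (HL := log_weight_ge_1 s Hs). assert (Hsq := force_sqr s Hs).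
  set (L := log_weight s) in *. set (a := force s) in *. set (P := potential s) in *.
  assert (H2 : 2 * L * (s * (a - a ^ 3 / 2)) <= 2 * L * P)
    by (apply Rmult_le_compat_l; lra).
  replace (2 * L * (s * (a - a ^ 3 / 2))) with (2 * L * (s * a) - s * a * (a ^ 2 * L))
    in H2 by field.
  rewrite Hsq in H2. lra. }
destruct (Rtotal_order x 0) as [Hx | [-> | Hx]].
- rewrite <- Rabs_Ropp, Rabs_pos_eq by lra.
  assert (H := Hpos (- x) ltac:(lra)). rewrite force_opp, potential_opp in H.
  replace (- x * - force x) with (x * force x) in H by ring. exact H.
- rewrite potential_0. lra.
- rewrite Rabs_pos_eq by lra. now apply Hpos.
Qed.

(** * Length of the motion *)

Definition damped_motion (x v : R -> R) : Prop :=
  x 0 = 1 / 4 /\ v 0 = 0 /\ (forall t, continuous v t) /\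
  (forall t, is_derive x t (v t)) /\
  (forall t, 0 < t -> is_derive v t (- (3 / t * v t) - force (x t))).

Definition lyapunov (x v : R -> R) (t : R) : R :=
  t ^ 2 * potential (x t) + 2 * (x t + t * v t / 2) ^ 2.

Lemma motion_continuous x v t : damped_motion x v -> continuous x t.
Proof.
intros (_ & _ & _ & Hx & _). apply (ex_derive_continuous x t). eexists. apply Hx.
Qed.

Lemma lyapunov_continuous x v t : damped_motion x v -> continuous (lyapunov x v) t.
Proof.
intros H. assert (Hx := motion_continuous x v t H).
destruct H as (_ & _ & Hv & _ & _). unfold lyapunov.
apply (continuous_plus (fun t => t ^ 2 * potential (x t))).
- apply (continuous_mult (fun t : R => t ^ 2)).
  + apply (ex_derive_continuous (fun t : R => t ^ 2)). auto_derive. exact I.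
  + apply (continuous_comp x potential); [exact Hx | apply potential_continuous].
- apply (continuous_comp (fun t => x t + t * v t / 2) (fun r => 2 * r ^ 2)).
  + apply (continuous_plus x); [exact Hx |].
    apply (continuous_mult (fun t => t * v t) (fun _ => / 2)); [| apply continuous_const].
    apply (continuous_mult (fun t : R => t)); [apply continuous_id | apply Hv].
  + apply (ex_derive_continuous (fun r : R => 2 * r ^ 2)). auto_derive. exact I.
Qed.

(** The mixed terms cancel exactly for the damping coefficient [3]. *)
Lemma lyapunov_derive x v t : damped_motion x v -> 0 < t ->
  is_derive (lyapunov x v) t (- 2 * t * (x t * force (x t) - potential (x t))).
Proof.
intros (_ & _ & _ & Hx & Hv) Ht. specialize (Hx t). specialize (Hv t Ht).
assert (HP := potential_derive (x t)).
unfold lyapunov. auto_derive.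
- repeat split; eexists; eassumption.
- rewrite (is_derive_unique (fun s : R => x s) _ _ Hx), (is_derive_unique (fun s : R => v s) _ _ Hv),
    (is_derive_unique (fun s : R => potential s) _ _ HP). field. lra.
Qed.

Lemma lyapunov_le x v t : damped_motion x v -> 0 <= t -> lyapunov x v t <= 1 / 8.
Proof.
intros H Ht.
assert (Hle : - lyapunov x v 0 <= - lyapunov x v t).
{ apply (nondecreasing_of_derive (fun t => - lyapunov x v t)
    (fun t => - (- 2 * t * (x t * force (x t) - potential (x t))))); [exact Ht | | |].
  - intros s _. apply (continuous_opp (lyapunov x v)). now apply lyapunov_continuous.
  - intros s Hs. apply (is_derive_opp (lyapunov x v)). apply lyapunov_derive; [exact H | lra].
  - intros s Hs. assert (Hp := potential_le (x s)). nra. }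
destruct H as (Hx0 & Hv0 & _). unfold lyapunov at 1 in Hle.
rewrite Hx0, Hv0 in Hle. lra.
Qed.

Lemma one_plus_ln_le t : 0 < t -> 1 + ln t <= t.
Proof.
intros Ht. assert (H := exp_ineq1_le (ln t)). rewrite exp_ln in H by exact Ht. exact H.
Qed.

(** Since [t ^ 2 P (x t)] is at most [1 / 8], it is enough that
    [P (1 / t) >= 1 / (4 t ^ 2)]; this is where the small starting point
    [1 / 4] is used. *)
Lemma motion_decay x v t : damped_motion x v -> 1 <= t -> Rabs (x t) <= / t.
Proof.
intros H Ht. destruct (Rle_lt_dec (Rabs (x t)) (/ t)) as [Hle | Hlt]; [exact Hle |].
exfalso.
assert (HE := lyapunov_le x v t H ltac:(lra)). unfold lyapunov in HE.
assert (Hit := Rinv_0_lt_compat t ltac:(lra)).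
assert (HP : / t * / (1 + t) / 2 <= potential (x t)).
{ apply Rle_trans with (Rabs (x t) * force (Rabs (x t)) / 2).
  - assert (Hf : / (1 + t) <= force (/ t)).
    { rewrite force_pos by exact Hit. unfold log_weight. rewrite Rinv_inv.
      assert (H1 := one_plus_ln_le (1 + t) ltac:(lra)).
      assert (H2 : 0 <= ln (1 + t)) by (rewrite <- ln_1; apply ln_le; lra).
      apply Rinv_le_contravar; [apply sqrt_lt_R0; lra |].
      apply Rle_trans with (sqrt ((1 + t) ^ 2)).
      - apply sqrt_le_1_alt. apply Rle_trans with (1 + t); [exact H1 | nra].
      - rewrite sqrt_pow2; lra. }
    assert (Hm := force_monotone (/ t) (Rabs (x t)) ltac:(lra)).
    assert (0 < / (1 + t)) by (apply Rinv_0_lt_compat; lra).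
    assert (/ t * / (1 + t) <= Rabs (x t) * force (Rabs (x t)))
      by (apply Rmult_le_compat; lra).
    lra.
  - replace (potential (x t)) with (potential (Rabs (x t))).
    + apply potential_ge_half. lra.
    + unfold Rabs. destruct (Rcase_abs (x t)); [apply potential_opp | reflexivity]. }
assert (H2 : t ^ 2 * (/ t * / (1 + t) / 2) <= t ^ 2 * potential (x t))
  by (apply Rmult_le_compat_l; [apply pow2_ge_0 | exact HP]).
assert (H3 : 1 / 4 <= t ^ 2 * (/ t * / (1 + t) / 2)).
{ replace (t ^ 2 * (/ t * / (1 + t) / 2)) with ((t / 2) / (1 + t)) by (field; lra).
  apply -> Rle_div_r; lra. }
assert (H4 := pow2_ge_0 (x t + t * v t / 2)).
lra.
Qed.

Lemma motion_defect x v t : damped_motion x v -> 1 <= t ->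
  (2 * ln t + 1) * (x t * force (x t) - potential (x t)) <= potential (x t).
Proof.
intros H Ht. assert (Hd := homogeneity_defect (x t)).
destruct (Req_dec (x t) 0) as [Hx | Hx].
{ rewrite Hx, potential_0. lra. }
assert (Hax := Rabs_pos_lt _ Hx).
assert (HL : 1 + ln t <= log_weight (Rabs (x t))).
{ assert (Ha := log_weight_antitone _ _ Hax (motion_decay x v t H Ht)).
  unfold log_weight in Ha at 1. rewrite Rinv_inv in Ha.
  assert (ln t <= ln (1 + t)) by (apply ln_le; lra). lra. }
assert (Hp := potential_le (x t)).
eapply Rle_trans; [| exact Hd]. apply Rmult_le_compat_r; lra.
Qed.

(** The crude bound [x P' - P <= P] makes [t ^ 2 E] nondecreasing, and [E] is
    positive at small times because [x] is still close to its initial value. *)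
Lemma lyapunov_1_pos x v : damped_motion x v -> 0 < lyapunov x v 1.
Proof.
intros H.
assert (Hc := motion_continuous x v 0 H).
destruct (proj1 (filterlim_locally x (x 0)) Hc (mkposreal (1 / 4) ltac:(lra))) as [d Hd].
set (s := Rmin (d / 2) 1). assert (Hdp := cond_pos d).
assert (Hs : 0 < s) by (apply Rmin_glb_lt; lra).
assert (Hs1 : s <= 1) by apply Rmin_r. assert (Hsd : s <= d / 2) by apply Rmin_l.
assert (Hxs : 0 < x s).
{ assert (Hb : ball 0 d s).
  { change (Rabs (s - 0) < d). rewrite Rminus_0_r, Rabs_pos_eq; lra. }
  specialize (Hd s Hb). change (Rabs (x s - x 0) < 1 / 4) in Hd.
  destruct H as (Hx0 & _). rewrite Hx0 in Hd. apply Rabs_def2 in Hd. lra. }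
assert (Hle : s ^ 2 * lyapunov x v s <= 1 ^ 2 * lyapunov x v 1).
{ apply (nondecreasing_of_derive (fun t => t ^ 2 * lyapunov x v t)
    (fun t => 2 * t * lyapunov x v t
              + t ^ 2 * (- 2 * t * (x t * force (x t) - potential (x t))))); [exact Hs1 | | |].
  - intros t _. apply (continuous_mult (fun t : R => t ^ 2)); [| now apply lyapunov_continuous].
    apply (ex_derive_continuous (fun t : R => t ^ 2)). auto_derive. exact I.
  - intros t Ht. evar_last.
    + apply (is_derive_mult (fun t : R => t ^ 2) (lyapunov x v) t (2 * t));
        [auto_derive; [exact I | ring] | apply lyapunov_derive; [exact H | lra]
        | intros; apply Rmult_comm].
    + reflexivity.
  - intros t Ht. unfold lyapunov.
    assert (Hd' : x t * force (x t) - potential (x t) <= potential (x t)).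
    { assert (Hp := potential_le (x t)). assert (Hh := homogeneity_defect (x t)).
      destruct (Req_dec (x t) 0) as [-> | Hx]; [rewrite potential_0; lra |].
      assert (HL := log_weight_ge_1 _ (Rabs_pos_lt _ Hx)). nra. }
    assert (H3 : 0 < t ^ 3) by (apply pow_lt; lra).
    assert (H4 := pow2_ge_0 (x t + t * v t / 2)). nra. }
assert (HE : 0 < s ^ 2 * lyapunov x v s).
{ unfold lyapunov. assert (Hp := potential_pos (x s) ltac:(lra)).
  assert (H2 : 0 < s ^ 2) by (apply pow_lt; lra).
  assert (H4 := pow2_ge_0 (x s + s * v s / 2)).
  apply Rmult_lt_0_compat; [exact H2 |]. nra. }
lra.
Qed.

(** The weight [2 ln t + 1] is chosen so that its product with [E] is
    nondecreasing: by [motion_defect] the loss of [E] is compensated by the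
    logarithmic derivative of the weight. *)
Lemma lyapunov_ge x v t : damped_motion x v -> 1 <= t ->
  lyapunov x v 1 / (2 * ln t + 1) <= lyapunov x v t.
Proof.
intros H Ht.
assert (Hln : 0 <= ln t) by (rewrite <- ln_1; apply ln_le; lra).
apply Rle_div_l; [lra |].
assert (Hle : lyapunov x v 1 * (2 * ln 1 + 1) <= lyapunov x v t * (2 * ln t + 1)).
{ apply (nondecreasing_of_derive (fun t => lyapunov x v t * (2 * ln t + 1))
    (fun t => - 2 * t * (x t * force (x t) - potential (x t)) * (2 * ln t + 1)
              + lyapunov x v t * (2 / t))); [exact Ht | | |].
  - intros s Hs. apply (continuous_mult (lyapunov x v)); [now apply lyapunov_continuous |].
    apply (ex_derive_continuous (fun t : R => 2 * ln t + 1)). auto_derive. lra.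
  - intros s Hs. evar_last.
    + apply (is_derive_mult (lyapunov x v) (fun t => 2 * ln t + 1) s
        (- 2 * s * (x s * force (x s) - potential (x s))) (2 / s));
        [apply lyapunov_derive; [exact H | lra] | auto_derive; [lra | field; lra]
        | intros; apply Rmult_comm].
    + reflexivity.
  - intros s Hs. assert (Hd := motion_defect x v s H ltac:(lra)).
    set (psi := x s * force (x s) - potential (x s)) in *. unfold lyapunov.
    assert (H4 := pow2_ge_0 (x s + s * v s / 2)).
    set (q := (_ + _) ^ 2) in *.
    replace ((s ^ 2 * potential (x s) + 2 * q) * (2 / s))
      with (2 * s * potential (x s) + 4 * q * / s) by (field; lra).
    assert (0 <= 4 * q * / s)
      by (apply Rmult_le_pos; [lra | left; apply Rinv_0_lt_compat; lra]).
    assert (s * ((2 * ln s + 1) * psi) <= s * potential (x s))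
      by (apply Rmult_le_compat_l; lra).
    nra. }
rewrite ln_1 in Hle. lra.
Qed.

Lemma velocity_decay x v t : damped_motion x v -> 1 <= t -> t * Rabs (v t) <= 5 / 2.
Proof.
intros H Ht.
assert (HE := lyapunov_le x v t H ltac:(lra)). unfold lyapunov in HE.
assert (Hp := potential_nonneg (x t)). assert (H2 := pow2_ge_0 t).
assert (Hq : (x t + t * v t / 2) ^ 2 <= (1 / 4) ^ 2) by nra.
assert (Hx := motion_decay x v t H Ht).
assert (Hi : / t <= 1) by (rewrite <- Rinv_1; apply Rinv_le_contravar; lra).
assert (Hq' : Rabs (x t + t * v t / 2) <= 1 / 4).
{ rewrite <- (Rabs_pos_eq (1 / 4)) by lra. apply Rsqr_le_abs_0. unfold Rsqr. nra. }
apply Rabs_le_between in Hq'. assert (Hx' : Rabs (x t) <= 1) by lra.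
apply Rabs_le_between in Hx'.
rewrite <- (Rabs_pos_eq t) at 1 by lra. rewrite <- Rabs_mult.
apply Rabs_le. lra.
Qed.

Lemma length_derive v t : (forall s, continuous v s) ->
  is_derive (fun T => RInt (fun t => Rabs (v t)) 0 T) t (Rabs (v t)).
Proof.
intros Hv.
assert (Hc : forall s, continuous (fun t => Rabs (v t)) s).
{ intros s. apply (continuous_comp v Rabs); [apply Hv | apply continuous_Rabs]. }
apply (is_derive_RInt (fun t => Rabs (v t)) (fun T => RInt (fun t => Rabs (v t)) 0 T) 0 t);
  [| apply Hc].
apply filter_forall. intros y. apply (RInt_correct (fun t => Rabs (v t))).
apply (ex_RInt_continuous (fun t => Rabs (v t))). intros z _. apply Hc.
Qed.

(** The comparison function [M] below collects the length, the virial
    boundary term and the integrals of the two error terms; the divergence comes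
    from [ln (2 ln t + 1)], a primitive of [2 / (t (2 ln t + 1))]. *)
Lemma length_diverges x v : damped_motion x v ->
  is_lim (fun T => RInt (fun t => Rabs (v t)) 0 T) p_infty p_infty.
Proof.
intros H.
set (A := fun T => RInt (fun t => Rabs (v t)) 0 T).
set (c := lyapunov x v 1). assert (Hc : 0 < c) by now apply lyapunov_1_pos.
(* The factor [5] absorbs the term [2 t v ^ 2] of the estimate, as [t |v|] is at most [5 / 2]. *)
set (M := fun t => 5 * A t - (t * x t * v t + x t ^ 2) - 2 / t ^ 2
                   - c / 2 * ln (2 * ln t + 1)).
assert (Hln : forall t, 1 <= t -> 0 <= ln t) by (intros; rewrite <- ln_1; apply ln_le; lra).
assert (HdM : forall t, 1 <= t ->
  is_derive M t (5 * Rabs (v t) - (t * v t ^ 2 - t * (x t * force (x t))) + 4 / t ^ 3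
                 - c / (2 * ln t + 1) / t)).
{ intros t Ht. specialize (Hln t Ht).
  assert (HA := length_derive v t (proj1 (proj2 (proj2 H)))). fold A in HA.
  assert (Hx := proj1 (proj2 (proj2 (proj2 H))) t).
  assert (Hv := proj2 (proj2 (proj2 (proj2 H))) t ltac:(lra)).
  unfold M. auto_derive.
  - repeat split; try (eexists; eassumption); try lra.
    change (t ^ 2 <> 0). apply pow_nonzero. lra.
  - rewrite (is_derive_unique (fun s : R => A s) _ _ HA), (is_derive_unique (fun s : R => x s) _ _ Hx),
      (is_derive_unique (fun s : R => v s) _ _ Hv). field. lra. }
assert (Hlow : forall T, 1 <= T -> M 1 <= M T).
{ intros T HT. eapply nondecreasing_of_derive; [exact HT | | intros t Ht; apply HdM; lra |].
  - intros t Ht. apply (ex_derive_continuous M t). eexists. apply HdM. lra.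
  - intros t Ht. cbv beta.
    assert (HE := lyapunov_ge x v t H ltac:(lra)). fold c in HE.
    assert (Hit := Rinv_0_lt_compat t ltac:(lra)).
    assert (HE' := Rmult_le_compat_r (/ t) _ _ ltac:(lra) HE).
    assert (Hxd := motion_decay x v t H ltac:(lra)).
    assert (Hvd := velocity_decay x v t H ltac:(lra)).
    assert (Hp := potential_le (x t)).
    assert (Hx2 : x t ^ 2 <= (/ t) ^ 2).
    { rewrite <- pow2_abs. apply pow_incr. split; [apply Rabs_pos | exact Hxd]. }
    assert (Hv2 : t * v t ^ 2 <= 5 / 2 * Rabs (v t)).
    { rewrite <- pow2_abs. assert (Ha := Rabs_pos (v t)). nra. }
    assert (HEt : lyapunov x v t * / t
      <= t * (x t * force (x t)) + t * v t ^ 2 + 4 / t ^ 3).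
    { apply Rle_trans with (t * potential (x t) + 4 * x t ^ 2 * / t + t * v t ^ 2).
      - unfold lyapunov. apply Rminus_le_0.
        replace (_ - _) with (2 * (x t - t * v t / 2) ^ 2 * / t) by (field; lra).
        apply Rmult_le_pos; [| lra].
        apply Rmult_le_pos; [lra | apply pow2_ge_0].
      - replace (4 / t ^ 3) with (4 * (/ t) ^ 2 * / t) by (field; lra).
        assert (t * potential (x t) <= t * (x t * force (x t)))
          by (apply Rmult_le_compat_l; lra).
        assert (4 * x t ^ 2 * / t <= 4 * (/ t) ^ 2 * / t)
          by (apply Rmult_le_compat_r; lra).
        lra. }
    change (c / (2 * ln t + 1) / t) with (c / (2 * ln t + 1) * / t). lra. }
assert (Hbelow : forall T, 1 <= T ->
  (M 1 - 5 / 2 + c / 2 * ln (2 * ln T + 1)) / 5 <= A T).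
{ intros T HT. specialize (Hlow T HT). unfold M at 2 in Hlow.
  assert (Hxd := motion_decay x v T H HT).
  assert (Hvd := velocity_decay x v T H HT).
  assert (Hi : / T <= 1) by (rewrite <- Rinv_1; apply Rinv_le_contravar; lra).
  assert (Hxv : Rabs (T * x T * v T) <= 5 / 2).
  { replace (T * x T * v T) with (x T * (T * v T)) by ring.
    rewrite Rabs_mult, Rabs_mult, (Rabs_pos_eq T) by lra.
    assert (Ha := Rabs_pos (x T)).
    assert (Hb : 0 <= T * Rabs (v T)) by (apply Rmult_le_pos; [lra | apply Rabs_pos]).
    nra. }
  apply Rabs_le_between in Hxv.
  assert (H2 := pow2_ge_0 (x T)).
  assert (H3 : 0 < 2 / T ^ 2) by (apply Rdiv_lt_0_compat; [lra | apply pow_lt; lra]).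
  lra. }
apply is_lim_spec. intros K.
(* The lower bound of [A T] exceeds [K] once [ln (2 ln T + 1)] exceeds [r]. *)
set (r := (5 * K - (M 1 - 5 / 2)) / (c / 2)).
exists (Rmax 1 (exp (exp r))). intros T HT.
assert (HT1 := Rle_lt_trans _ _ _ (Rmax_l _ _) HT).
assert (HT2 := Rle_lt_trans _ _ _ (Rmax_r _ _) HT).
assert (Hr : r < ln (2 * ln T + 1)).
{ rewrite <- (ln_exp r). apply ln_increasing; [apply exp_pos |].
  assert (Hl : exp r < ln T).
  { rewrite <- (ln_exp (exp r)). apply ln_increasing; [apply exp_pos | exact HT2]. }
  assert (He := exp_pos r). lra. }
specialize (Hbelow T ltac:(lra)).
apply (Rmult_lt_compat_l (c / 2)) in Hr; [| lra].
replace (c / 2 * r) with (5 * K - (M 1 - 5 / 2)) in Hr by (unfold r; field; lra).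
fold (A T). lra.
Qed.

(** * The planar potential and the trajectory *)

Definition separable_potential (z : R2) : R := potential (fst z) + snd z ^ 2 / 2.

Lemma separable_potential_grad z : grad separable_potential z = (force (fst z), snd z).
Proof.
unfold grad, separable_potential. cbn [fst snd]. f_equal; apply is_derive_unique.
- evar_last.
  + apply (is_derive_plus potential (fun _ => snd z ^ 2 / 2));
      [apply potential_derive | apply @is_derive_const].
  + apply Rplus_0_r.
- auto_derive; [exact I | field].
Qed.

Lemma separable_potential_convex : convex_fun separable_potential.
Proof.
intros [x1 x2] [y1 y2] l Hl. unfold separable_potential, plus, scal; simpl.
unfold plus, scal, mult; simpl. unfold mult; simpl.
assert (H := convex_of_monotone_derive potential force x1 y1 l
  potential_derive force_monotone Hl).
assert (H2 : 0 <= l * (1 - l) * (x2 - y2) ^ 2).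
{ apply Rmult_le_pos; [apply Rmult_le_pos; lra | apply pow2_ge_0]. }
nra.
Qed.

Lemma separable_potential_C1 : continuously_differentiable separable_potential.
Proof.
split.
- intros [x y].
  apply (filterdiff_ext_lin (separable_potential) 
    (fun h : R2 => plus (scal (fst h) (force x)) (scal (snd h) y))).
  + apply (is_derive_filterdiff (fun a b => potential a + b ^ 2 / 2) x y (fun a _ => force a) y).
    * apply filter_forall. intros [a b]. cbn [fst snd]. evar_last.
      -- apply (is_derive_plus potential (fun _ => b ^ 2 / 2));
           [apply potential_derive | apply @is_derive_const].
      -- apply Rplus_0_r.
    * auto_derive; [exact I | field].
    * apply (continuous_comp fst force); [apply continuous_fst | apply force_continuous].
  + intros [h k]. rewrite separable_potential_grad. unfold inner. cbn [fst snd].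
    unfold plus, scal; simpl. unfold mult; simpl. ring.
- intros z. apply (continuous_ext (fun z : R2 => (force (fst z), snd z))).
  { intros y. symmetry. apply separable_potential_grad. }
  apply (continuous_comp_2 (fun z : R2 => force (fst z)) (fun z : R2 => snd z) pair).
  + apply (continuous_comp fst force); [apply continuous_fst | apply force_continuous].
  + apply continuous_snd.
  + apply (continuous_ext (fun p : R2 => p)); [now intros [a b] | apply continuous_id].
Qed.

Lemma separable_potential_minimizer : unique (minimizer separable_potential) zero.
Proof.
assert (H0 : separable_potential zero = 0).
{ unfold separable_potential, zero; simpl. unfold zero; simpl. rewrite potential_0. field. }
split.
- intros [x y]. rewrite H0. unfold separable_potential. cbn [fst snd].
  assert (H1 := potential_nonneg x). assert (H2 := pow2_ge_0 y). lra.
- intros [x y] Hmin. specialize (Hmin zero). rewrite H0 in Hmin.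
  unfold separable_potential in Hmin. cbn [fst snd] in Hmin.
  assert (H1 := potential_nonneg x). assert (H2 := pow2_ge_0 y).
  destruct (Req_dec x 0) as [-> | Hx].
  + destruct (Req_dec y 0) as [-> | Hy]; [reflexivity |].
    assert (H3 := pow2_gt_0 y Hy). lra.
  + assert (H3 := potential_pos x Hx). lra.
Qed.

Lemma derivative_on_axis (D : R -> Prop) (x x' : R -> R) :
  (forall t, D t -> is_derive x t (x' t)) ->
  derivative_on D (fun t => (x t, 0)) (fun t => (x' t, 0)).
Proof.
intros Hx t Ht.
assert (Hd : is_derive (fun s => (x s, 0) : R2) t ((x' t, 0) : R2)).
{ apply (is_derive_ext (fun s => scal (x s) ((1, 0) : R2))).
  - intros s. change ((x s * 1, x s * 0) = (x s, 0)). f_equal; ring.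
  - evar_last; [apply (is_derive_scal_l x t (x' t) ((1, 0) : R2)), Hx, Ht |].
    change ((x' t * 1, x' t * 0) = (x' t, 0)). f_equal; ring. }
assert (Hprop : ProperFilter (within D (locally t))).
{ split; [| apply within_filter, locally_filter].
  intros P HP. exists t. exact (locally_singleton _ _ HP Ht). }
apply (filterdiff_locally (F := within D (locally t)) _ t); [| exact Hd].
intros P HP. apply filter_le_within, HP.
Qed.

Lemma continuous_axis (x : R -> R) t :
  continuous x t -> continuous (fun t => (x t, 0) : R2) t.
Proof.
intros Hx.
apply (continuous_comp_2 x (fun _ => 0) pair); [exact Hx | apply continuous_const |].
apply (continuous_ext (fun p : R2 => p)); [now intros [a b] | apply continuous_id].
Qed.

Theorem theorem2p1 :
  exists (f : R2 -> R) (X0 : R2) (X X' : R -> R2),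
    convex_fun f /\
    continuously_differentiable f /\
    unique (minimizer f) zero /\
    X0 <> zero /\
    global_solution f X0 X X' /\
    is_lim (fun T => RInt (fun t => norm (X' t)) 0 T) p_infty p_infty.
Proof.
destruct (damped_oscillator_exists force 1 (1 / 4) force_continuous force_bound)
  as (x & v & Hx0 & Hv0 & Hv & Dx & Dv).
assert (Hm : damped_motion x v) by exact (conj Hx0 (conj Hv0 (conj Hv (conj Dx Dv)))).
exists separable_potential, (1 / 4, 0), (fun t => (x t, 0)), (fun t => (v t, 0)).
split; [apply separable_potential_convex |].
split; [apply separable_potential_C1 |].
split; [apply separable_potential_minimizer |].
split; [intros H; apply (f_equal fst) in H; change (1 / 4 = 0) in H; lra |].
split; [split; [| split; [| split; [| split]]] |].
- apply derivative_on_axis. intros t _. apply Dx.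
- apply continuous_on_forall. intros t _. apply continuous_axis, Hv.
- now rewrite Hx0.
- now rewrite Hv0.
- exists (fun t => (- (3 / t * v t) - force (x t), 0)). split; [| split].
  + apply derivative_on_axis. exact Dv.
  + apply continuous_on_forall. intros t Ht. apply continuous_axis.
    apply (continuous_minus (fun t => - (3 / t * v t)) (fun t => force (x t))).
    * apply (continuous_opp (fun t => 3 / t * v t)).
      apply (continuous_mult (fun t => 3 / t) v); [| apply Hv].
      apply (ex_derive_continuous (fun t : R => 3 / t)). auto_derive. lra.
    * apply (continuous_comp x force); [| apply force_continuous].
      now apply motion_continuous with v.
  + intros t Ht. rewrite separable_potential_grad. cbn [fst snd].
    change ((- (3 / t * v t) - force (x t) + 3 / t * v t + force (x t),
             0 + 3 / t * 0 + 0) = (0, 0)). apply (f_equal2 pair); ring.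
- apply (is_lim_ext (fun T => RInt (fun t => Rabs (v t)) 0 T)).
  + intros T. apply RInt_ext. intros t _. rewrite norm_R2. cbn [fst snd].
    replace (v t ^ 2 + 0 ^ 2) with (Rsqr (v t)) by (unfold Rsqr; ring).
    symmetry. apply sqrt_Rsqr_abs.
  + now apply length_diverges with x.
Qed.
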